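(* Let $(q,\alpha)$ and $(q',\alpha')$ be two pairs of real parameters. For $i,j\in\mathbb Z$ let $$A_i=\{\omega\in\Omega: F_{q,\alpha'}(\omega,q')\in[\alpha'+i,\alpha'+i+1)\},\qquad B_j=\{\omega\in\Omega: F_{q,\alpha}(\omega,q)\in[\alpha'-j,\alpha'-j+1)\},$$ and let $k=\min\{i\in\mathbb Z:\mathbb P(A_i)>0\}$ and $l=\min\{j\in\mathbb Z:\mathbb P(B_j)>0\}$. Then $$\rho_{q',\alpha'}=\rho_{q,\alpha}+\mathbb P(A_k)-\mathbb P(B_l)-k+l .$$
   Context: $(\Omega,\mathcal F,\mathbb P)$ is a probability space, $\theta:\Omega\to\Omega$ is a measure-preserving transformation that is ergodic with respect to $\mathbb P$, and $f:\Omega\times S^1\to S^1$ is a random variable with values in $\mathcal H^+$, the space of orientation-preserving homeomorphisms of $S^1$. The covering map is $p:\mathbb R\to S^1$, $p(x)=e^{2\pi i x}$. A lift of $g\in\mathcal H^+$ is an increasing continuous function $G:\mathbb R\to\mathbb R$ with $p\circ G=g\circ p$; lifts are unique up to addition of an integer. For $a,b\in\mathbb R$, $F_{a,b}(\omega,\cdot)$ denotes the unique lift of $f(\omega,\cdot)$ with $F_{a,b}(\omega,a)\in[b,b+1)$. The $(a,b)$-rotation number is $\rho_{a,b}=\lim_{n\to\infty}\frac{F^n(\omega,x)-x}{n}$, where $F^n(\omega,x)=F_{a,b}(\theta^{n-1}\omega,\cdot)\circ\cdots\circ F_{a,b}(\omega,x)$; this limit exists for $\mathbb P$-almost every $\omega$,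 is independent of $x\in\mathbb R$ and is $\mathbb P$-a.s. equal to a constant, so the asserted identity is between ($\mathbb P$-a.s. constant) real numbers. *)

(* Defs.v *)
From mathcomp Require Import all_boot all_order all_algebra.
From mathcomp Require Export complex.
From mathcomp Require Import all_classical all_reals all_analysis.

Set Implicit Arguments.
Unset Strict Implicit.
Unset Printing Implicit Defensive.

Import Order.TTheory GRing.Theory Num.Theory numFieldNormedType.Exports.

Local Open Scope classical_set_scope.
Local Open Scope ring_scope.

(* As a type, this is the subtype of the complex plane with the topology and
   the uniformity induced by the modulus: [R[i]^o] is [R[i]] with the structures
   coming from its norm. *)
Definition circle (R : realType) : set (R[i]^o) := [set z | `|z| = 1].
Arguments circle : clear implicits.

Lemma circle_cexp (R : realType) (t : R) :
  (Complex (cos t) (sin t) : R[i]^o) \in circle R.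
Proof.
by rewrite inE /circle /= normc_def /= cos2Dsin2 sqrtr1.
Qed.

(* The covering map x |-> e^{2 pi i x}. *)
Definition covering (R : realType) (x : R) : circle R :=
  SigSub (circle_cexp (2 * pi * x)).

Definition is_lift (R : realType) (g : circle R -> circle R) (G : R -> R) :=
  [/\ {homo G : x y / x < y}, continuous G &
      forall x, covering (G x) = g (covering x)].

Definition homeomorphism (X : topologicalType) (g : X -> X) :=
  continuous g /\ exists h : X -> X, [/\ continuous h, cancel g h & cancel h g].

(* A homeomorphism of the circle preserves the orientation when it is covered by
   an increasing map of the line (otherwise its continuous lifts decrease). *)
Definition orientation_preserving_homeo (R : realType) :
    set (circle R -> circle R) :=
  [set g | homeomorphism g /\ exists G : R -> R, is_lift g G].

(* Measurability is with respect to the Borel sets of the topology of uniform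
   convergence on the space of homeomorphisms. As all the values lie in that
   space, open sets of maps may be used instead of their traces on it. *)
Definition random_circle_homeo (R : realType) d (Omega : measurableType d)
    (f : Omega -> circle R -> circle R) :=
  (forall w, orientation_preserving_homeo (f w)) /\
  (forall U : set {uniform (circle R) -> (circle R)},
     open U -> measurable [set w | U (f w)]).

Definition measure_preserving (R : realType) d (Omega : measurableType d)
    (P : probability Omega R) (theta : Omega -> Omega) :=
  measurable_fun [set: Omega] theta /\
  (forall A, measurable A -> P (theta @^-1` A) = P A).

Definition ergodic (R : realType) d (Omega : measurableType d)
    (P : probability Omega R) (theta : Omega -> Omega) :=
  forall A, measurable A -> theta @^-1` A = A -> P A = 0%E \/ P A = 1%E.

(* The unique lift G of [f w] with b <= G a < b + 1; the default value [id] is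
   never used when [f w] is an orientation-preserving homeomorphism. *)
Definition lift_ab (R : realType) (Omega : Type)
    (f : Omega -> circle R -> circle R) (a b : R) (w : Omega) : R -> R :=
  xget (id : R -> R) [set G | is_lift (f w) G /\ b <= G a < b + 1].

Fixpoint cocycle (R : realType) (Omega : Type) (theta : Omega -> Omega)
    (F : Omega -> R -> R) (n : nat) (w : Omega) (x : R) : R :=
  if n is m.+1 then F (iter m theta w) (cocycle theta F m w x) else x.

(* The almost sure constant value of the limit of (F^n(w, x) - x) / n, for all x.
   At most one real satisfies the predicate, so that the default value 0 matters
   only if the limit fails to exist. *)
Definition rotation_number (R : realType) d (Omega : measurableType d)
    (P : probability Omega R) (theta : Omega -> Omega)
    (f : Omega -> circle R -> circle R) (a b : R) : R :=
  xget 0 [set r | {ae P, forall w, forall x : R,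
    ((cocycle theta (lift_ab f a b) n w x - x) / n%:R) @[n --> \oo] --> r}].

(* The least element of E, with default value 0 if there is none. *)
Definition int_min (E : set int) : int := xget 0 (E `&` lbound E).

(* Main.v *)
Require Import Defs.
From mathcomp Require Import all_boot all_order all_algebra.
From mathcomp Require Import all_classical all_reals all_analysis.
From mathcomp Require Import measurable_realfun zify ring lra.
Import Order.TTheory GRing.Theory Num.Theory numFieldNormedType.Exports.
Local Open Scope classical_set_scope.
Local Open Scope ring_scope.

Set Implicit Arguments.
Unset Strict Implicit.
Unset Printing Implicit Defensive.

(* Two lifts of the same circle homeomorphism differ by an integer, so that
   F_{q',alpha'} = F_{q,alpha} + J - I, where J = j on B_j and I = i on A_i; iterating
   adds to the displacement the ergodic sums of J - I. The displacement F^n(w, 0) is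
   additive up to an error 1 along the orbits, since every lift has degree one; hence
   F^n(w, 0) / n converges almost surely to the limit of E[F^n(., 0)] / n, by a
   Katznelson-Weiss covering argument. Therefore the two rotation numbers differ by
   E[J] - E[I]. Finally, I and J take at most two consecutive values, and the mean of
   such a variable X is k + 1 - P(X = k), where k is its least value of positive
   probability. *)

(** * The covering map and the lifts *)

Section Covering.
Variable R : realType.
Implicit Types (x y s u : R) (n : int).

Lemma periodic_int (V : zmodType) (h : R -> V) (T : R) n x :
  periodic h T -> h (x + n%:~R * T) = h x.
Proof.
move=> hT; case: n => n.
  by rewrite -pmulrn mulr_natl periodicn.
by rewrite NegzE intrN -pmulrn mulNr mulr_natl -[in RHS](subrK (T *+ n.+1) x) periodicn.
Qed.

Lemma covering_Dint x n : covering (x + n%:~R) = covering x.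
Proof.
apply: val_inj => /=.
have -> : 2 * pi * (x + n%:~R) = 2 * pi * x + n%:~R * (pi *+ 2) :> R.
  by rewrite mulr2n; ring.
by rewrite !periodic_int//; [exact: sinD2pi|exact: cosD2pi].
Qed.

(** The fractional part [z] of [y - x] satisfies cos(2 pi z) = 1, and cosine is injective on
    [0, pi]; a [z] above 1/2 is first reflected to [1 - z], which would then vanish although
    [z < 1]. *)
Lemma covering_inj x y : covering x = covering y -> exists n : int, y = x + n%:~R.
Proof.
move=> /(congr1 val) /= [] hc hs.
exists (Num.floor (y - x)).
set n := Num.floor _; set z := y - x - n%:~R.
suff z0 : z = 0 by move: z0; rewrite /z; lra.
have /andP[z_ge0 z_lt1] : 0 <= z < 1.
  by have := floor_itv (y - x); rewrite -/n intrD /z => /andP[]; lra.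
have cz : cos (2 * pi * z) = 1.
  have -> : 2 * pi * z = (2 * pi * y - 2 * pi * x) + (- n)%:~R * (pi *+ 2).
    by rewrite /z mulr2n intrN; ring.
  rewrite periodic_int; last exact: cosD2pi.
  by rewrite cosB hc hs -!expr2 cos2Dsin2.
have pi0 := pi_gt0 R.
have [zh|zh] := leP z (1/2).
  have : 2 * pi * z = 0.
    apply: (@cos_inj R); rewrite ?in_itv/= ?cos0 ?lexx//.
      by apply/andP; split; nra.
    by lra.
  by move=> /eqP; rewrite !mulf_eq0 pnatr_eq0/= (gt_eqF pi0) => /eqP.
have : 2 * pi * (1 - z) = 0.
  apply: (@cos_inj R); rewrite ?in_itv/= ?cos0 ?lexx//.
  - by apply/andP; split; nra.
  - by lra.
  - have -> : 2 * pi * (1 - z) = - (2 * pi * z) + pi *+ 2 by rewrite mulr2n; ring.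
    by rewrite cosD2pi cosN.
move=> /eqP; rewrite !mulf_eq0 pnatr_eq0/= (gt_eqF pi0) subr_eq0 => /eqP; lra.
Qed.

Lemma covering_continuous : continuous (fun x => set_val (covering x) : R[i]^o).
Proof.
move=> x; apply/cvgrPdist_lt => e.
(* The tolerance lives in [R[i]], where positivity forces the imaginary part to vanish, so [e] can
   be taken real. *)
rewrite ltcE /= => /andP[/eqP Ime0]; case: e Ime0 => e _ /= -> e0.
have e2 : 0 < e / 2 by lra.
have c2 : continuous (fun x : R => 2 * pi * x) by move=> t; exact: mulrl_continuous.
have cc : {for x, continuous (fun x : R => cos (2 * pi * x))}.
  by apply: continuous_comp; [exact: c2|exact: continuous_cos].
have cs : {for x, continuous (fun x : R => sin (2 * pi * x))}.
  by apply: continuous_comp; [exact: c2|exact: continuous_sin].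
near=> y.
have : `|cos (2 * pi * x) - cos (2 * pi * y)| < e / 2.
  by near: y; move/cvgrPdist_lt : cc; exact.
have : `|sin (2 * pi * x) - sin (2 * pi * y)| < e / 2.
  by near: y; move/cvgrPdist_lt : cs; exact.
rewrite normc_def /= ltcR.
set a := sin _ - _; set b := cos _ - _ => ha hb.
apply: (@le_lt_trans _ _ (`|a| + `|b|)); last by lra.
have ab0 : 0 <= `|a| + `|b| by rewrite addr_ge0.
rewrite -[leRHS]ger0_norm// -sqrtr_sqr ler_sqrt ?sqr_ge0//.
have := normr_ge0 a; have := normr_ge0 b.
by rewrite -[a ^+ 2]real_normK ?num_real// -[b ^+ 2]real_normK ?num_real//; nra.
Unshelve. all: by end_near. Qed.

Lemma closed_arc s u : closed [set (set_val (covering x) : R[i]^o) | x in `[s, u]].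
Proof.
apply: compact_closed; first exact: norm_hausdorff.
apply: continuous_compact; last exact: segment_compact.
by apply: continuous_subspaceT => x; exact: covering_continuous.
Qed.

(** Link between the uniform topology, in which [f] is measurable, and evaluation at a point: the
    event that [f w] sends [z] into a closed set becomes measurable. *)
Lemma open_eval (z : circle R) (C : set R[i]^o) : closed C ->
  open [set g : {uniform (circle R) -> (circle R)} | ~ C (set_val (g z))].
Proof.
move=> cC; rewrite openE => g /= gC.
have oC : open [set y : circle R | ~ C (set_val y)].
  by exists (~` C) => //; exact: closed_openC.
have : nbhs (g z) [set y : circle R | ~ C (set_val y)] by exact: open_nbhs_nbhs.
rewrite -nbhs_entourageE => -[E entE EC].
apply/uniform_nbhs; exists E; split => // h hE.
by apply: EC; apply/xsectionP; exact: hE.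
Qed.
End Covering.

(** * Monotonicity, degree and uniqueness of lifts *)

Section Lifts.
Variable R : realType.
Implicit Types (x y a b : R) (n : int) (g : circle R -> circle R) (G : R -> R).

Lemma int_small_eq0 n : -1 < n%:~R :> R -> n%:~R < 1 :> R -> n = 0.
Proof.
move=> n_gt n_lt.
have : (-1 < n)%R by rewrite -(ltr_int R) intrN.
have : (n < 1)%R by rewrite -(ltr_int R).
lia.
Qed.

(** Were [G y] at least [G x + 1], the intermediate value theorem would give [z] in [x, y] with
    [G z = G x + 1]. Injectivity of [g] makes [z - x] an integer, hence 0, which is absurd. *)
Lemma lift_lt_add1 g G x y : injective g -> is_lift g G ->
  x < y < x + 1 -> G x < G y < G x + 1.
Proof.
move=> gI [Ginc Gc pG] /andP[xy yx]; rewrite Ginc//= ltNge; apply/negP => le1.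
have [z /[!in_itv]/= /andP[xz zy] Gz] : exists2 z, z \in `[x, y] & G z = G x + 1.
  apply: IVT; [exact: ltW|exact: continuous_subspaceT|].
  by rewrite ge_min le_max le1 lerDl ler01 !orbT.
have : covering z = covering x.
  by apply: gI; rewrite -!pG Gz -[1](@mulr1z R) covering_Dint.
move=> /covering_inj[n xzn].
have n0 : n = 0 by apply: int_small_eq0; lra.
by move: xzn Gz; rewrite n0 addr0 => ->; lra.
Qed.

Definition degree_one G := {homo G : x y / x < y} /\ forall x, G (x + 1) = G x + 1.

(** The difference [G (x + 1) - G x] is an integer, positive by monotonicity, and at most 1 by
    continuity at [x + 1], since [G] stays below [G x + 1] just to the left of that point. *)
Lemma lift_degree_one g G : injective g -> is_lift g G -> degree_one G.
Proof.
move=> gI lG; have [Ginc Gc pG] := lG; split => // x.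
have /covering_inj[n Gn] : covering (G x) = covering (G (x + 1)).
  by rewrite !pG -[1](@mulr1z R) covering_Dint.
have lt1 : G x < G (x + 1) by apply: Ginc; lra.
have le1 : G (x + 1) <= G x + 1.
  apply/ler_addgt0Pr => e e0.
  have /cvgrPdist_lt/(_ e e0) := Gc (x + 1).
  move=> /nbhs_ballP[d /= d0 dG].
  (* The bound [d / 2] keeps [x + 1 - h] in the ball, the bound [1 / 2] keeps it inside (x, x +
     1). *)
  pose h := Num.min (d / 2) (1 / 2).
  have h0 : 0 < h by rewrite /h lt_min; lra.
  have hd : h <= d / 2 by rewrite /h ge_min lexx.
  have h1 : h <= 1 / 2 by rewrite /h ge_min lexx orbT.
  have /dG : ball (x + 1) d (x + 1 - h).
    by rewrite /ball /= opprB addrC subrK gtr0_norm//; lra.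
  have /andP[_] : G x < G (x + 1 - h) < G x + 1 by apply: (lift_lt_add1 gI lG); lra.
  by rewrite /= ltr_norml => ? /andP[]; lra.
have n1 : n - 1 = 0 by apply: int_small_eq0; rewrite intrD; lra.
have -> : G (x + 1) = G x + n%:~R by [].
by rewrite (_ : n = 1)//; lia.
Qed.

Lemma degree_one_Dint G x n : degree_one G -> G (x + n%:~R) = G x + n%:~R.
Proof.
move=> [_ G1].
have Gn (m : nat) y : G (y + m%:R) = G y + m%:R.
  elim: m y => [|m IH] y; first by rewrite !addr0.
  by rewrite -addn1 natrD addrA G1 IH addrA.
case: n => n; first by rewrite -pmulrn.
rewrite NegzE intrN -pmulrn -[in RHS](subrK n.+1%:R x) Gn; ring.
Qed.

Lemma floor_decomp x y : exists n z, y = z + n%:~R /\ x <= z < x + 1.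
Proof.
exists (Num.floor (y - x)), (y - (Num.floor (y - x))%:~R); rewrite subrK; split => //.
by have := floor_itv (y - x); rewrite intrD; lra.
Qed.

(** The displacement is 1-periodic, so [y] may be moved into [x, x + 1), where both [y - x] and
    [G y - G x] lie in [0, 1). *)
Lemma degree_one_dist G x y : degree_one G -> `|(G y - y) - (G x - x)| <= 1.
Proof.
move=> dG; have [Ginc G1] := dG; have [n [z [-> /andP[xz zx]]]] := floor_decomp x y.
rewrite degree_one_Dint//.
have : G x <= G z by move: xz; rewrite le_eqVlt => /predU1P[->//|/Ginc/ltW].
by have := Ginc _ _ zx; rewrite G1 ler_norml; lra.
Qed.

Lemma lift_Dint g G n : is_lift g G -> is_lift g (fun x => G x + n%:~R).
Proof.
move=> [Ginc Gc pG]; split => [x y xy|x|x]; first by rewrite ltrD2r Ginc.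
- by apply: cvgD; [exact: Gc|exact: cvg_cst].
- by rewrite covering_Dint.
Qed.

(** The lifts differ by an integer at each point. Both increase by less than 1 between 0 and a point
    of (0, 1), so this integer agrees with the one at 0; degree one extends this to the line. *)
Lemma lift_unique g G G' : injective g -> is_lift g G -> is_lift g G' ->
  exists n, forall x, G' x = G x + n%:~R.
Proof.
move=> gI lG lG'; have [_ _ pG] := lG; have [_ _ pG'] := lG'.
have dG := lift_degree_one gI lG; have dG' := lift_degree_one gI lG'.
have cn x : exists n, G' x = G x + n%:~R.
  by apply: covering_inj; rewrite pG pG'.
have [n n0] := cn 0; exists n => y.
have [k [z [-> z01]]] := floor_decomp 0 y; rewrite !degree_one_Dint//.
suff -> : G' z = G z + n%:~R by ring.
have [->//|z0] := eqVneq z 0.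
have z0' : 0 < z < 0 + 1.
  by move: z01 => /andP[]; rewrite le_eqVlt eq_sym (negbTE z0)/= => -> ->.
have [m zm] := cn z.
have := lift_lt_add1 gI lG z0'; have := lift_lt_add1 gI lG' z0'.
move=> /andP[? ?] /andP[? ?].
have mn : m - n = 0 by apply: int_small_eq0; rewrite intrD intrN; lra.
by rewrite zm (_ : m = n)//; lia.
Qed.

Lemma homeomorphism_inj g : homeomorphism g -> injective g.
Proof. by move=> [_ [h [_ gK _]]]; exact: can_inj gK. Qed.

Section LiftAB.
Variables (Omega : Type) (f : Omega -> circle R -> circle R).
Hypothesis fH : forall w, orientation_preserving_homeo (f w).

(** Rules out the default value of [xget]: any lift [G], translated by minus the floor of [G a - b],
    meets the normalization. *)
Lemma lift_abP a b w : is_lift (f w) (lift_ab f a b w) /\ b <= lift_ab f a b w a < b + 1.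
Proof.
have [_ [G lG]] := fH w.
rewrite /lift_ab; case: xgetP => [G' _ [] //|].
move=> /(_ (fun x => G x + (- Num.floor (G a - b))%:~R)).
case; split; first exact: lift_Dint.
by have := floor_itv (G a - b); rewrite intrD intrN; lra.
Qed.

Let fI w : injective (f w). Proof. by have [/homeomorphism_inj] := fH w. Qed.

Lemma lift_ab_degree_one a b w : degree_one (lift_ab f a b w).
Proof. by have [lG _] := lift_abP a b w; exact: lift_degree_one lG. Qed.

Lemma lift_ab_continuous a b w : continuous (lift_ab f a b w).
Proof. by have [[]] := lift_abP a b w. Qed.

Lemma lift_ab_unique a b a' b' w :
  exists n, forall x, lift_ab f a' b' w x = lift_ab f a b w x + n%:~R.
Proof.
by have [l _] := lift_abP a b w; have [l' _] := lift_abP a' b' w; exact: lift_unique l l'.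
Qed.

(* On [a, a + 1) the lift stays in [F a, F a + 1), so that [f w] evaluated at the
   two points a and x already determines it. *)
Lemma lift_ab_eval a b w x (Y := fun z => lift_ab f z b w z) : a <= x < a + 1 ->
  lift_ab f a b w x = Y x + (Y x < Y a)%R%:R.
Proof.
move=> ax; have [_ Yx] := lift_abP x b w; have [la Ya] := lift_abP a b w.
have Fx : Y a <= lift_ab f a b w x < Y a + 1.
  move: ax => /andP[]; rewrite le_eqVlt => /predU1P[<- _|ax xa].
    by rewrite lexx ltrDl ltr01.
  have /andP[/ltW -> ->//] : Y a < lift_ab f a b w x < Y a + 1.
  by apply: lift_lt_add1 la _; rewrite ?ax.
have [n Fn] := lift_ab_unique x b a b w.
rewrite -/(Y x) in Yx; rewrite -/(Y a) in Ya; rewrite !Fn -/(Y x) in Fx *.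
case: (ltP (Y x) (Y a)) => YY /=.
  have -> // : n = 1.
  have n0 : n - 1 = 0 by apply: int_small_eq0; rewrite intrD; lra.
  lia.
have -> // : n = 0 by apply: int_small_eq0; lra.
Qed.

Lemma lift_ab_bounded a b w : `|lift_ab f a b w 0| <= `|a| + `|b| + 2.
Proof.
have [_] := lift_abP a b w; have := degree_one_dist 0 a (lift_ab_degree_one a b w).
have := ler_norm a; have := ler_norm (- a); have := ler_norm b; have := ler_norm (- b).
rewrite !normrN; move: `|a| `|b| => na nb; rewrite !ler_norml => *; lra.
Qed.

End LiftAB.

End Lifts.

(** * Measurability of the lifts and of their iterates *)

Section Measurability.
Context {R : realType} d (Omega : measurableType d).

Lemma measurable_fun_superlevel (h : Omega -> R) :
  (forall t, measurable [set w | t < h w]) -> measurable_fun setT h.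
Proof.
move=> hm; apply: (measurability _ (@RGenOInfty.measurableE R)) => _ [_ [t ->] <-].
rewrite setTI (_ : _ @^-1` _ = [set w | t < h w])//.
by apply/seteqP; split => w /=; rewrite in_itv/= andbT.
Qed.

Lemma measurable_fun_sublevel (h : Omega -> R) :
  (forall t, measurable [set w | h w <= t]) -> measurable_fun setT h.
Proof.
move=> hm; apply: measurable_fun_superlevel => t.
rewrite (_ : [set w | _] = ~` [set w | h w <= t]); first exact: measurableC.
by apply/seteqP; split => w /=; rewrite ltNge => /negP.
Qed.

Lemma measurable_setlt (h k : Omega -> R) : measurable_fun setT h ->
  measurable_fun setT k -> measurable [set w | h w < k w].
Proof.
move=> hm km; have := measurable_fun_ltr hm km.
by move=> /(_ measurableT [set true] I); rewrite setTI.
Qed.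

Lemma measurable_setle (h k : Omega -> R) : measurable_fun setT h ->
  measurable_fun setT k -> measurable [set w | h w <= k w].
Proof.
move=> hm km; have := measurable_fun_ler hm km.
by move=> /(_ measurableT [set true] I); rewrite setTI.
Qed.

(** By monotonicity and continuity, [t < F w (Y w)] holds exactly when [t < F w r] for some rational
    [r < Y w]; this is a countable union of measurable events. *)
Lemma measurable_eval_increasing (F : Omega -> R -> R) (Y : Omega -> R) :
  (forall w, {homo F w : x y / x < y}) -> (forall w, continuous (F w)) ->
  (forall x, measurable_fun setT (F ^~ x)) -> measurable_fun setT Y ->
  measurable_fun setT (fun w => F w (Y w)).
Proof.
move=> Finc Fc Fm Ym; apply: measurable_fun_superlevel => t.
rewrite (_ : [set w | _] = \bigcup_(r : rat)
    ([set w | ratr r < Y w] `&` [set w | t < F w (ratr r)])).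
  apply: bigcupT_measurable_rat => r; apply: measurableI; exact: measurable_setlt.
apply/seteqP; split => w /=; last first.
  by move=> [r _ [/= rY]] /lt_trans; apply; exact: Finc.
move=> tF; have /cvgrPdist_lt/(_ (F w (Y w) - t)) := Fc w (Y w).
rewrite subr_gt0 => /(_ tF) /nbhs_ballP[e /= e0 eF].
have [r] := @rat_in_itvoo R (Y w - e) (Y w) ltac:(lra).
rewrite in_itv/= => /andP[r1 r2]; exists r => //; split => //=.
have /eF/= : ball (Y w) e (ratr r) by rewrite /ball /= gtr0_norm; lra.
by rewrite gtr0_norm ?subr_gt0 ?Finc//; lra.
Qed.

Lemma measurable_fun_iter (theta : Omega -> Omega) n :
  measurable_fun setT theta -> measurable_fun setT (iter n theta).
Proof.
move=> mt; elim: n => [|n IH]; first exact: measurable_id.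
exact: (measurableT_comp mt IH).
Qed.

Section Cocycle.
Variables (theta : Omega -> Omega) (F : Omega -> R -> R).

Lemma measurable_cocycle n x : measurable_fun setT theta ->
  (forall w, {homo F w : x y / x < y}) -> (forall w, continuous (F w)) ->
  (forall x, measurable_fun setT (F ^~ x)) ->
  measurable_fun setT (fun w => cocycle theta F n w x).
Proof.
move=> mt Finc Fc Fm; elim: n => [|n IH] /=; first exact: measurable_cst.
apply: (@measurable_eval_increasing (fun w => F (iter n theta w))) => // y.
exact: (measurableT_comp (Fm y) (measurable_fun_iter n mt)).
Qed.

Lemma cocycleD m n w x :
  cocycle theta F (m + n) w x = cocycle theta F n (iter m theta w) (cocycle theta F m w x).
Proof. by elim: n => [|n IH]; rewrite ?addn0// addnS /= IH -iterD addnC. Qed.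

Hypothesis dF : forall w, degree_one (F w).

Lemma cocycle_degree_one n w : degree_one (cocycle theta F n w).
Proof.
elim: n => [|n [IH1 IH2]]; first by split.
have [Finc F1] := dF (iter n theta w).
by split => [x y xy|x] /=; [exact/Finc/IH1|rewrite IH2 F1].
Qed.

Lemma cocycle_dist n w x y :
  `|(cocycle theta F n w y - y) - (cocycle theta F n w x - x)| <= 1.
Proof. exact/degree_one_dist/cocycle_degree_one. Qed.

(** The last [n] steps start from the point reached at time [m] instead of 0, and displacements from
    two starting points differ by at most 1. *)
Lemma cocycle0_almost_additive m n w :
  `|cocycle theta F (m + n) w 0 - cocycle theta F m w 0
    - cocycle theta F n (iter m theta w) 0| <= 1.
Proof.
rewrite cocycleD.
by have := cocycle_dist n (iter m theta w) 0 (cocycle theta F m w 0); rewrite subr0.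
Qed.

End Cocycle.

Variable f : Omega -> circle R -> circle R.
Hypothesis fH : random_circle_homeo f.

(** For [t] in [b, b + 1), the lift at [a] is at most [t] exactly when [f w] sends the projection of
    [a] into the closed arc covered by [b, t]; for other [t] the event is empty or full. *)
Lemma measurable_lift_diag a b : measurable_fun setT (fun w => lift_ab f a b w a).
Proof.
have [oH mf] := fH; apply: measurable_fun_sublevel => t.
have [tb|bt] := ltP t b.
  rewrite (_ : [set w | _] = set0)//; apply/seteqP; split => w //=.
  by have [_] := lift_abP oH a b w; lra.
have [bt1|tb1] := leP (b + 1) t.
  rewrite (_ : [set w | _] = setT)//; apply/seteqP; split => w //= _.
  by have [_] := lift_abP oH a b w; lra.
have := mf _ (@open_eval R (covering a) _ (@closed_arc R b t)).
move=> /measurableC; congr measurable; apply/seteqP; split => w /=;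
  have [[_ _ pF] Fab] := lift_abP oH a b w.
  move=> /contrapT[y /[!in_itv]/= /andP[b_y yt]]; rewrite -pF => /val_inj.
  move=> /covering_inj[n Fy]; have n0 : n = 0 by apply: int_small_eq0; lra.
  by move: Fy; rewrite n0 addr0 => ->.
move=> Ft; apply; exists (lift_ab f a b w a); last by rewrite pF.
by rewrite in_itv/= Ft; lra.
Qed.

Lemma measurable_lift_ab a b x : measurable_fun setT (fun w => lift_ab f a b w x).
Proof.
have [oH mf] := fH; have [n [z [-> az]]] := floor_decomp a x.
rewrite (_ : (fun w => _) = fun w => lift_ab f z b w z
    + (if lift_ab f z b w z < lift_ab f a b w a then 1 else 0) + n%:~R).
  apply: measurable_funD => //; apply: measurable_funD; first exact: measurable_lift_diag.
  apply: measurable_fun_ifT => //.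
  by apply: measurable_fun_ltr; exact: measurable_lift_diag.
apply/funext => w; rewrite degree_one_Dint; last exact: lift_ab_degree_one.
by rewrite lift_ab_eval//; case: ifP.
Qed.

End Measurability.

(** * Almost additive cocycles over an ergodic transformation *)

Section BoundedRV.
Context {R : realType} d (Omega : measurableType d) (P : probability Omega R).
Implicit Types h k : Omega -> R.

Definition bounded_rv h := measurable_fun setT h /\ exists M, forall w, `|h w| <= M.

Lemma bounded_rv_integrable h : bounded_rv h -> P.-integrable setT (EFin \o h).
Proof.
move=> [mh [M hM]]; apply: measurable_bounded_integrable => //.
  by rewrite (le_lt_trans (probability_le1 P measurableT))// ltry.
exists M; split; first exact: num_real.
by move=> y My w _; apply: (le_trans (hM w)); exact: ltW.
Qed.

Lemma bounded_rv_cst (r : R) : bounded_rv (cst r).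
Proof. by split; [exact: measurable_cst|exists `|r|]. Qed.

Lemma bounded_rvD h k : bounded_rv h -> bounded_rv k -> bounded_rv (fun w => h w + k w).
Proof.
move=> [mh [M hM]] [mk [N kN]]; split; first exact: measurable_funD.
by exists (M + N) => w; rewrite (le_trans (ler_normD _ _))// lerD.
Qed.

Lemma bounded_rvM h k : bounded_rv h -> bounded_rv k -> bounded_rv (fun w => h w * k w).
Proof.
move=> [mh [M hM]] [mk [N kN]]; split; first exact: measurable_funM.
by exists (M * N) => w; rewrite normrM ler_pM.
Qed.

Lemma bounded_rvB h k : bounded_rv h -> bounded_rv k -> bounded_rv (fun w => h w - k w).
Proof.
move=> [mh [M hM]] [mk [N kN]]; split; first exact: measurable_funB.
by exists (M + N) => w; rewrite (le_trans (ler_normB _ _))// lerD.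
Qed.

Lemma bounded_rv_indic A : measurable A -> bounded_rv (\1_A : Omega -> R).
Proof.
move=> mA; split; first exact: measurable_indic.
by exists 1 => w; rewrite indicE; case: (_ \in _); rewrite ?normr1 ?normr0.
Qed.

Lemma Rintegral_prob_cst (r : R) : \int[P]_w r = r.
Proof.
rewrite Rintegral_cst// -[RHS]mulr1; congr (_ * _).
exact: (congr1 fine (probability_setT P)).
Qed.

Lemma Rintegral_prob_indic A : measurable A -> \int[P]_w (\1_A w : R) = fine (P A).
Proof. by move=> mA; rewrite /Rintegral integral_indic// setIT. Qed.

Lemma bounded_rv_dist h k r : bounded_rv h -> bounded_rv k ->
  (forall w, `|h w - k w| <= r) -> `|\int[P]_w h w - \int[P]_w k w| <= r.
Proof.
move=> bh bk hk; have bhk := bounded_rvB bh bk.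
rewrite -RintegralB//; try exact: bounded_rv_integrable.
apply: (le_trans (le_normr_Rintegral _ _)) => //; first exact: bounded_rv_integrable.
rewrite -[leRHS]Rintegral_prob_cst; apply: le_Rintegral => //.
- exact/integrable_norm/bounded_rv_integrable.
- exact/bounded_rv_integrable/bounded_rv_cst.
Qed.

Section MeasurePreserving.
Variable theta : Omega -> Omega.
Hypothesis mp : measure_preserving P theta.

Lemma bounded_rv_comp h : bounded_rv h -> bounded_rv (h \o theta).
Proof.
move=> [mh [M hM]]; split; first exact: measurableT_comp mh mp.1.
by exists M => w /=.
Qed.

Lemma bounded_rv_iter n h : bounded_rv h -> bounded_rv (fun w => h (iter n theta w)).
Proof.
elim: n => [//|n IH] /IH /bounded_rv_comp.
by congr bounded_rv; apply/funext => w /=; rewrite -iterSr.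
Qed.

Lemma Rintegral_comp h : bounded_rv h -> \int[P]_w h (theta w) = \int[P]_w h w.
Proof.
move=> bh; have [mt Pt] := mp; rewrite /Rintegral; congr fine.
have := @integral_pushforward _ _ _ _ R theta mt P setT (EFin \o h).
rewrite preimage_setT => /(_ _ _ measurableT) <-.
- by apply: eq_measure_integral => A mA _; exact: Pt.
- by apply/measurable_EFinP; exact: bh.1.
- exact: (bounded_rv_integrable (bounded_rv_comp bh)).
Qed.

Lemma Rintegral_iter n h : bounded_rv h -> \int[P]_w h (iter n theta w) = \int[P]_w h w.
Proof.
move=> bh; elim: n => [//|n IH]; rewrite -IH.
rewrite -(Rintegral_comp (bounded_rv_iter n bh)).
by apply: eq_Rintegral => w _; rewrite -iterSr.
Qed.

Lemma birkhoff_sum n h : bounded_rv h ->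
  bounded_rv (fun w => \sum_(i < n) h (iter i theta w)) /\
  \int[P]_w (\sum_(i < n) h (iter i theta w)) = n%:R * \int[P]_w h w.
Proof.
move=> bh; elim: n => [|n [IH1 IH2]].
  rewrite (_ : (fun w => _) = cst 0); last by apply/funext => w; rewrite big_ord0.
  by split; [exact: bounded_rv_cst|rewrite mul0r Rintegral_prob_cst].
have bn := bounded_rv_iter n bh.
rewrite (_ : (fun w => _) = fun w => \sum_(i < n) h (iter i theta w) + h (iter n theta w));
  last by apply/funext => w; rewrite big_ord_recr.
split; first exact: bounded_rvD.
rewrite RintegralD//; try exact: bounded_rv_integrable.
by rewrite IH2 Rintegral_iter// -natr1 mulrDl mul1r.
Qed.

End MeasurePreserving.
End BoundedRV.

(** * Almost additive real sequences and rates of growth *)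

Section Sequences.
Variable R : realType.
Implicit Types (u v : nat -> R) (a c : R).

(** Each [u (m * n)] is within [m] of [m%:R * u n] and, symmetrically, within [n] of [n%:R * u m].
    Hence the ratios at [m] and [n] differ by at most 1/m + 1/n, and they form a Cauchy sequence. *)
Lemma almost_additive_cvg u : u 0%N = 0 ->
  (forall m n, `|u (m + n)%N - u m - u n| <= 1) -> cvgn (fun n => u n / n%:R).
Proof.
move=> u0 uD.
have umul m n : `|u (m * n)%N - m%:R * u n| <= m%:R.
  elim: m => [|m IH]; first by rewrite mul0n u0 mul0r subrr normr0.
  have := uD n (m * n)%N; rewrite -mulSn -natr1.
  by move: IH; rewrite !ler_norml; lra.
have ucomp m n : `|m.+1%:R * u n.+1 - n.+1%:R * u m.+1| <= m.+1%:R + n.+1%:R.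
  have := umul n.+1 m.+1; have := umul m.+1 n.+1; rewrite mulnC.
  by rewrite !ler_norml; lra.
apply: cauchy_cvg; apply: cauchy_exP => e e0.
have [N Ne] : exists N, 2 / e < N.+1%:R.
  by exists (Num.truncn (2 / e)); exact: truncnS_gt.
exists (u N.+1 / N.+1%:R), N.+1 => // -[//|n] /= Nn.
have n0 : 0 < n.+1%:R :> R by []. have N0 : 0 < N.+1%:R :> R by [].
have Nn' : N.+1%:R <= n.+1%:R :> R by rewrite ler_nat.
rewrite /ball /=.
have -> : u N.+1 / N.+1%:R - u n.+1 / n.+1%:R =
    (n.+1%:R * u N.+1 - N.+1%:R * u n.+1) / (N.+1%:R * n.+1%:R).
  rewrite -mulNr addf_div ?gt_eqF//; congr (_ / _); ring.
rewrite normrM normfV [X in _ / X]gtr0_norm ?mulr_gt0// ltr_pdivrMr ?mulr_gt0//.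
apply: (le_lt_trans (ucomp n N)).
move: Ne; rewrite ltr_pdivrMr//; move: n0 N0 Nn'; set x := N.+1%:R; set y := n.+1%:R.
by move=> *; nra.
Qed.

(* [limsup u n / n >= c] *)
Definition growth_ge u c :=
  forall e, 0 < e -> forall M, exists2 n, (M <= n)%N & n%:R * (c - e) <= u n.

(** Countably many tolerances suffice, which makes the growth event measurable. *)
Lemma growth_ge_inv_nat u c :
  (forall k M, exists2 n, (M <= n)%N & n%:R * (c - k.+1%:R^-1) <= u n) <-> growth_ge u c.
Proof.
split=> [uc e e0 M|uc k M]; last exact: uc.
have [n Mn ucn] := uc (Num.truncn e^-1) M; exists n => //.
apply: le_trans ucn; rewrite ler_wpM2l// lerB//.
by rewrite invf_ple ?posrE//; exact/ltW/truncnS_gt.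
Qed.

(** A bounded error and a shift of the index by one vanish after division by [n]. This gives the
    invariance of the growth event under [theta]. *)
Lemma growth_ge_shift u v c C : (forall n, `|u n.+1 - v n| <= C) ->
  growth_ge u c <-> growth_ge v c.
Proof.
move=> uv.
have C0 : 0 <= C by apply: le_trans (uv 0%N).
have large e : 0 < e ->
    exists K, forall n : nat, (K <= n)%N -> C + `|c| + e <= n%:R * (e / 2).
  move=> e0; exists (Num.truncn ((C + `|c| + e) / (e / 2))).+1 => n Kn.
  rewrite -ler_pdivrMr ?divr_gt0//; apply: (le_trans (ltW (truncnS_gt _))).
  by rewrite ler_nat.
split=> H e e0 M; have [K KP] := large _ e0;
  have [n + ncn] := H (e / 2) ltac:(lra) (M + K).+1.
  case: n ncn => [//|n] ncn nMK; exists n; first lia.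
  have := KP n ltac:(lia); have := uv n; rewrite ler_norml.
  have := ler_norm c; have := ler_norm (- c); rewrite normrN.
  move: ncn; rewrite -[n.+1%:R]natr1; lra.
move=> nMK; exists n.+1; first lia.
have := KP n ltac:(lia); have := uv n; rewrite ler_norml.
have := ler_norm c; have := ler_norm (- c); rewrite normrN.
by move: ncn; rewrite -[n.+1%:R]natr1; lra.
Qed.

End Sequences.

(** * Pathwise growth bounded by mean growth *)

Section MeanGrowth.
Context {R : realType} d (Omega : measurableType d) (P : probability Omega R).
Variable theta : Omega -> Omega.

Definition almost_additive_rv (phi : nat -> Omega -> R) (C : R) :=
  [/\ forall n, measurable_fun setT (phi n), forall w, phi 0%N w = 0,
    forall w, `|phi 1%N w| <= C &
    forall m n w, `|phi (m + n)%N w - phi m w - phi n (iter m theta w)| <= 1].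

Section Pointwise.
Variables (phi : nat -> Omega -> R) (C : R).
Hypothesis aa : almost_additive_rv phi C.

Lemma almost_additive_bound n w : `|phi n w| <= n%:R * (C + 1).
Proof.
have [_ phi0 phi1 phiD] := aa.
elim: n w => [|n IH] w; first by rewrite phi0 normr0 mul0r.
have := phiD 1%N n w; have := phi1 w; have := IH (theta w).
by rewrite add1n -[n.+1%:R]natr1 !ler_norml /=; lra.
Qed.

Lemma almost_additive_bounded_rv n : bounded_rv (phi n).
Proof.
have [mphi _ _ _] := aa; split => //; exists (n%:R * (C + 1)) => w.
exact: almost_additive_bound.
Qed.

(** Since [theta] preserves [P], the means themselves form an almost additive real sequence. *)
Lemma almost_additive_expectation : measure_preserving P theta ->
  cvgn (fun n => \int[P]_w phi n w / n%:R).
Proof.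
move=> mp; have [_ phi0 phi1 phiD] := aa.
have bphi := almost_additive_bounded_rv.
apply: almost_additive_cvg => [|m n].
  by under eq_Rintegral do rewrite phi0; rewrite Rintegral_prob_cst.
rewrite -addrA -opprD -(Rintegral_iter mp m (bphi n)).
have bnm := bounded_rv_iter mp m (bphi n).
rewrite -RintegralD//; try exact: bounded_rv_integrable.
apply: bounded_rv_dist => // [|w]; first exact: bounded_rvD.
by rewrite opprD addrA.
Qed.

(* Katznelson-Weiss covering argument: follow the orbit of w, jumping by a block of
   length in [M, K] on which phi grows at rate c when there is one, and by a single
   step at the points of B, where there may be none. *)
Lemma covering_bound (M K : nat) c (B : set Omega) : (0 < M)%N ->
  (forall w, ~ B w -> exists2 n, (M <= n <= K)%N & n%:R * c <= phi n w) ->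
  forall L w, L%:R * c - L%:R / M%:R
      - (C + 1 + `|c|) * \sum_(i < L) \1_B (iter i theta w) - (C + 1 + `|c|) * K%:R
    <= phi L w.
Proof.
move=> M0 good; have [_ phi0 phi1 phiD] := aa.
have M0' : 0 < M%:R :> R by rewrite ltr0n.
(* Cost of a single step: [C] for its increment, 1 for the additivity error, and the amount [c] that
   the step fails to earn. *)
set D := C + 1 + `|c|.
have D0 : 0 <= D.
  by have := le_trans (normr_ge0 _) (phi1 point); rewrite /D; have := normr_ge0 c; lra.
have Dc : - D <= - (C + 1) - c by have := ler_norm c; rewrite /D; lra.
clearbody D.
have S0 L w : 0 <= \sum_(i < L) \1_B (iter i theta w) :> R by exact: sumr_ge0.
(* Induction on the length still to be covered. Once it is at most [K], the crude linear bound is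
   charged to the term [D * K%:R]. *)
elim/ltn_ind => L IH w; have [LK|KL] := leqP L K.
  have := almost_additive_bound L w; rewrite ler_norml => /andP[phiL _].
  apply: le_trans phiL.
  have LM : 0 <= L%:R / M%:R :> R by rewrite divr_ge0.
  have DS := mulr_ge0 D0 (S0 L w).
  have LK' : L%:R <= K%:R :> R by rewrite ler_nat.
  have : L%:R * D <= D * K%:R by rewrite mulrC ler_wpM2l.
  have : L%:R * - D <= L%:R * (- (C + 1) - c) by rewrite ler_wpM2l.
  lra.
have [Bw|/good[n /andP[Mn nK] ncphi]] := pselect (B w).
  case: L IH KL => [//|L] IH KL.
  have := IH L (ltnSn L) (theta w); have := phiD 1%N L w; have := phi1 w.
  have -> : \sum_(i < L.+1) \1_B (iter i theta w) =
      1 + \sum_(i < L) \1_B (iter i theta (theta w)) :> R.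
    rewrite big_ord_recl /= indicE mem_set//; congr (_ + _).
    by apply: eq_bigr => i _; rewrite -iterSr.
  rewrite add1n /= => p1 p2.
  have M1 : 0 <= 1 / M%:R :> R by rewrite divr_ge0.
  move: p1 p2; rewrite !ler_norml -[L.+1%:R]natr1 !mulrDl !mulrDr; lra.
have [l Ll] : exists l, L = (n + l)%N by exists (L - n)%N; lia.
rewrite {}Ll in IH KL *.
have := IH l ltac:(lia) (iter n theta w); have := phiD n l w.
(* Joining a block to the rest costs an error 1, paid by its share of [L%:R / M%:R] because its
   length is at least [M]. *)
have nM : 1 <= n%:R / M%:R :> R by rewrite ler_pdivlMr// mul1r ler_nat.
have -> : \sum_(i < n + l) \1_B (iter i theta w) =
    \sum_(i < n) \1_B (iter i theta w) +
    \sum_(i < l) \1_B (iter i theta (iter n theta w)) :> R.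
  rewrite big_split_ord /=; congr (_ + _).
  by apply: eq_bigr => i _; rewrite addnC iterD.
have := mulr_ge0 D0 (S0 n w).
by rewrite natrD !ler_norml !mulrDr !mulrDl; lra.
Qed.

End Pointwise.

Hypothesis mp : measure_preserving P theta.

Lemma measurable_growth_ge (phi : nat -> Omega -> R) c :
  (forall n, measurable_fun setT (phi n)) -> measurable [set w | growth_ge (phi ^~ w) c].
Proof.
move=> mphi.
rewrite (_ : [set w | _] = \bigcap_k \bigcap_M \bigcup_(n in [set n | (M <= n)%N])
    [set w | n%:R * (c - k.+1%:R^-1) <= phi n w]).
  apply: bigcapT_measurable => k; apply: bigcapT_measurable => M.
  apply: bigcup_measurable => n _.
  by apply: measurable_setle => //; exact: measurable_cst.
apply/seteqP; split => w /= H.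
  by move=> k _ M _; have [n] := (growth_ge_inv_nat _ _).2 H k M; exists n.
by apply/growth_ge_inv_nat => k M; have [n] := H k I M I; exists n.
Qed.

(** The set [B K] of points without a good block of length in [M, K] has small probability for large
    [K]. Integrating [covering_bound] and dividing by a large [L] then bounds the mean growth from
    below by nearly [c]. *)
Lemma growth_le_expectation phi C a c : almost_additive_rv phi C ->
  (fun n => \int[P]_w phi n w / n%:R) @ \oo --> a ->
  P [set w | growth_ge (phi ^~ w) c] = 1%E -> c <= a.
Proof.
move=> aa ea Pc; have [mphi phi0 phi1 phiD] := aa.
apply/ler_addgt0Pr => e e0.
have e5 : 0 < e / 5 by lra.
(* Five losses of [e / 5] are allowed: the lowered rate [c'], the overhead 1/M, the visits to [B K],
   the remainder [D * K%:R] divided by [L], and the distance to the limit [a]. *)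
set c' := c - e / 5; set D := C + 1 + `|c'|.
have D0 : 0 <= D.
  by have := le_trans (normr_ge0 _) (phi1 point); rewrite /D; have := normr_ge0 c'; lra.
have [M M0 Me] : exists2 M, (0 < M)%N & M%:R^-1 <= e / 5.
  exists (Num.truncn (e / 5)^-1).+1 => //.
  by rewrite invf_ple ?posrE ?divr_gt0//; exact/ltW/truncnS_gt.
pose B K := [set w | forall n, (M <= n <= K)%N -> phi n w < n%:R * c'].
have mB K : measurable (B K).
  rewrite (_ : B K = ~` \bigcup_(n in [set n | (M <= n <= K)%N])
      [set w | n%:R * c' <= phi n w]).
    apply: measurableC; apply: bigcup_measurable => n _.
    by apply: measurable_setle => //; exact: measurable_cst.
  apply/seteqP; split => w /= H.
    by move=> [n nMK] /=; rewrite leNgt H.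
  by move=> n nMK; rewrite ltNge; apply/negP => ?; apply: H; exists n.
have [K DK] : exists K, D * fine (P (B K)) <= e / 5.
  have mcap : measurable (\bigcap_K B K) by exact: bigcapT_measurable.
  (* A point of every [B K] has no block of length at least [M] with rate [c'], so it violates the
     growth condition at tolerance [e / 5]. *)
  have P0 : P (\bigcap_K B K) = 0%E.
    have mU := measurable_growth_ge c mphi.
    have PU : P (~` [set w | growth_ge (phi ^~ w) c]) = 0%E.
      transitivity (1 - P [set w | growth_ge (phi ^~ w) c])%E; last by rewrite Pc subee.
      exact: probability_setC.
    apply: (subset_measure0 mcap (measurableC mU)) PU => w Bw /=.
    move=> /(_ _ e5 M)[n Mn]; rewrite leNgt (Bw n I n)//.
    by rewrite Mn leqnn.
  have : P \o B @ \oo --> 0%:E.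
    suff : P \o B @ \oo --> P (\bigcap_K B K) by rewrite P0.
    apply: nonincreasing_cvg_mu => //.
      by rewrite (le_lt_trans (probability_le1 P (mB 0%N)))// ltry.
    move=> i j ij; apply/subsetPset => w Bj n /andP[Mn ni]; apply: Bj.
    by rewrite Mn (leq_trans ni ij).
  move=> /fine_cvgP[_] /cvgrPdist_lt/(_ (e / 5 / (D + 1))).
  have D1 : 0 < D + 1 by lra.
  move=> /(_ (divr_gt0 e5 D1)) [K _ /(_ K (leqnn K))] /=.
  rewrite sub0r normrN ger0_norm ?fine_ge0// ltr_pdivlMr// => PK; exists K.
  have := fine_ge0 (measure_ge0 P (B K)); lra.
have good w : ~ B K w -> exists2 n, (M <= n <= K)%N & n%:R * c' <= phi n w.
  move=> nB; apply: contrapT => H; apply: nB => n nMK.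
  by rewrite ltNge; apply/negP => ?; apply: H; exists n.
have eL L : L%:R * c' - L%:R / M%:R - D * (L%:R * fine (P (B K))) - D * K%:R
    <= \int[P]_w phi L w.
  have [bS ES] := birkhoff_sum mp L (bounded_rv_indic (mB K)).
  rewrite -Rintegral_prob_indic// -ES.
  set S := fun w => \sum_(i < L) _ in bS *.
  have bDS := bounded_rvM (bounded_rv_cst Omega D) bS.
  have -> : L%:R * c' - L%:R / M%:R - D * \int[P]_w S w - D * K%:R =
      \int[P]_w (L%:R * c' - L%:R / M%:R - D * K%:R - D * S w).
    rewrite RintegralB//; last exact: (bounded_rv_integrable P bDS).
      rewrite Rintegral_prob_cst RintegralZl//; last exact: bounded_rv_integrable.
      by ring.
    exact/bounded_rv_integrable/bounded_rv_cst.
  apply: le_Rintegral => //.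
  - apply: bounded_rv_integrable; apply: bounded_rvB => //; exact: bounded_rv_cst.
  - exact/bounded_rv_integrable/(almost_additive_bounded_rv aa).
  - by move=> w _; have := covering_bound aa M0 good L w; rewrite -/D /S; lra.
move/cvgrPdist_lt : ea => /(_ _ e5) [L0 _ HL].
(* Large enough both for the convergence of the means and for [D * K%:R <= e / 5 * L%:R]. *)
set L := (maxn L0 (Num.truncn ((e / 5)^-1 * (D * K%:R)))).+1.
have /HL/= : (L0 <= L)%N by rewrite /L; lia.
have L_gt0 : 0 < L%:R :> R by rewrite ltr0n.
have LK : D * K%:R <= e / 5 * L%:R.
  rewrite -ler_pdivrMl//; apply: (le_trans (ltW (truncnS_gt _))).
  by rewrite ler_nat ltnS leq_maxr.
have := eL L; rewrite ltr_norml => eL' /andP[+ _].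
rewrite ltrBrDl -ltrBrDr opprK ltr_pdivrMr//.
move: eL' LK DK Me; rewrite /c'; move: (L%:R) L_gt0 => x x0.
move: (M%:R^-1) (fine _) (\int[P]_w _) => m p y *.
nra.
Qed.

End MeanGrowth.

(** * Almost sure convergence and the mean of a two-valued variable *)

Section ErgodicTheorem.
Context {R : realType} d (Omega : measurableType d) (P : probability Omega R).
Variable theta : Omega -> Omega.
Hypotheses (mp : measure_preserving P theta) (erg : ergodic P theta).

Lemma almost_additive_rvN (phi : nat -> Omega -> R) C : almost_additive_rv theta phi C ->
  almost_additive_rv theta (fun n w => - phi n w) C.
Proof.
move=> [mphi phi0 phi1 phiD]; split.
- by move=> n; exact: measurable_funN.
- by move=> w; rewrite phi0 oppr0.
- by move=> w; rewrite normrN.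
- by move=> m n w; rewrite -!opprD normrN.
Qed.

(** Growth at a rate above [a] is an invariant event, of probability 0 or 1 by ergodicity;
    probability 1 would contradict [growth_le_expectation]. *)
Lemma almost_additive_upper (phi : nat -> Omega -> R) C a :
  almost_additive_rv theta phi C ->
  (fun n => \int[P]_w phi n w / n%:R) @ \oo --> a ->
  {ae P, forall w, forall k, exists N, forall n, (N <= n)%N ->
     phi n w <= n%:R * (a + k.+1%:R^-1)}.
Proof.
move=> aa ea; have [mphi phi0 phi1 phiD] := aa.
apply/ae_foralln => k; set c := a + _.
have mU := measurable_growth_ge c mphi.
have shift w n : `|phi n.+1 w - phi n (theta w)| <= C + 1.
  have := phiD 1%N n w; have := phi1 w; rewrite add1n /= !ler_norml; lra.
have Uinv : theta @^-1` [set w | growth_ge (phi ^~ w) c] = [set w | growth_ge (phi ^~ w) c].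
  apply/seteqP; split => w /=; [exact: (growth_ge_shift c (shift w)).2|].
  exact: (growth_ge_shift c (shift w)).1.
exists [set w | growth_ge (phi ^~ w) c]; split => //.
- have [//|/(growth_le_expectation mp aa ea)] := erg mU Uinv.
  by rewrite /c -[leRHS]addr0 lerD2l leNgt invr_gt0 ltr0Sn.
- move=> w /= H e e0 M; apply: contrapT => nH; apply: H; exists M => n Mn.
  rewrite leNgt; apply/negP => lt; apply: nH; exists n => //.
  by apply: le_trans (ltW lt); rewrite ler_wpM2l// gerBl ltW.
Qed.

(** The upper bound applied to [phi] and to its opposite encloses the limit. *)
Lemma almost_additive_ergodic (phi : nat -> Omega -> R) C :
  almost_additive_rv theta phi C ->
  exists a : R, (fun n => \int[P]_w phi n w / n%:R) @ \oo --> a /\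
    {ae P, forall w, phi n w / n%:R @[n --> \oo] --> a}.
Proof.
move=> aa; have [mphi phi0 phi1 phiD] := aa.
have bphi := almost_additive_bounded_rv aa.
have /cvg_ex[a ea] := almost_additive_expectation aa mp.
exists a; split => //.
have eNa : (fun n => \int[P]_w (- phi n w) / n%:R) @ \oo --> - a.
  rewrite (_ : (fun n => _) = fun n => - (\int[P]_w phi n w / n%:R)); first exact: cvgN.
  apply/funext => n; rewrite -mulNr; congr (_ / _).
  under eq_Rintegral do rewrite -mulN1r.
  by rewrite RintegralZl ?mulN1r//; exact: bounded_rv_integrable.
have := almost_additive_upper (almost_additive_rvN aa) eNa.
have := almost_additive_upper aa ea.
apply: filterS2 => w up lo; apply/cvgrPdist_le => e e0.
have [N1 {}up] := up (Num.truncn e^-1).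
have [N2 {}lo] := lo (Num.truncn e^-1).
have ke : (Num.truncn e^-1).+1%:R^-1 <= e.
  by rewrite invf_ple ?posrE//; exact/ltW/truncnS_gt.
exists (maxn N1 N2).+1 => // -[//|n] /= nN.
have n0 : 0 < n.+1%:R :> R by [].
have := up n.+1 ltac:(lia); have := lo n.+1 ltac:(lia).
rewrite -!ler_pdivrMl// mulrN [_^-1 * _]mulrC ler_norml.
move: (_^-1) (_ / _) ke => m x me lo_x up_x; apply/andP; split; lra.
Qed.

Lemma int_minE (E : set int) k : E k -> lbound E k -> int_min E = k.
Proof.
move=> Ek kE; apply: xget_subset1 => // m n [Em mE] [En nE].
by apply/eqP; rewrite eq_le mE//= nE.
Qed.

(** Since [X] equals [n + 1] minus the indicator of [A n], its mean is [n + 1] minus the probability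
    of [A n]; if that probability is positive, then [k = n]. *)
Lemma Rintegral_two_valued (X : Omega -> int) (A : int -> set Omega) n :
  measurable_fun setT (fun w => (X w)%:~R : R) ->
  (forall i w, A i w <-> X w = i) ->
  (forall w, n <= X w <= n + 1) ->
  let k := int_min [set i : int | (0 < P (A i))%E] in
  \int[P]_w (X w)%:~R = k%:~R + 1 - fine (P (A k)).
Proof.
move=> mX AX Xn k.
have mA : measurable (A n).
  rewrite (_ : A n = [set w | (X w)%:~R <= n%:~R :> R]).
    by apply: measurable_setle => //; exact: measurable_cst.
  apply/seteqP; split => w /=; rewrite ler_int; first by move/AX ->.
  by move=> Xw; apply/AX; have := Xn w; lia.
have EX : \int[P]_w (X w)%:~R = n%:~R + 1 - fine (P (A n)).
  rewrite -Rintegral_prob_indic// -[X in _ = X - _](Rintegral_prob_cst P) -RintegralB//.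
  - apply: eq_Rintegral => w _; rewrite indicE.
    have [/set_mem/AX ->|/negP nA] := boolP (w \in A n); first by rewrite addrK.
    have -> : X w = n + 1; last by rewrite intrD subr0.
    have : X w <> n by move=> /AX/mem_set.
    by have := Xn w; lia.
  - exact/bounded_rv_integrable/bounded_rv_cst.
  - exact/bounded_rv_integrable/bounded_rv_indic.
have A0 i : i < n -> A i = set0.
  by move=> i_n; apply/seteqP; split => w //= /AX; have := Xn w; lia.
have lbn i : (0 < P (A i))%E -> n <= i.
  by rewrite leNgt; apply: contraTN => /A0 ->; rewrite measure0 ltxx.
have [PAn|] := ltP 0%E (P (A n)).
  by rewrite EX /k (int_minE (k := n)).
(* If [A n] is null, then [X = n + 1] almost surely and [k = n + 1]; the formula survives because
   [A k] then has probability 1. *)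
rewrite measure_le0 => /eqP PAn.
have PAn1 : P (A (n + 1)) = 1%E.
  have -> : A (n + 1) = ~` A n.
    apply/seteqP; split => w /=; first by move=> /AX Xw /AX; lia.
    move=> nA; apply/AX; have Xwn : X w <> n by move=> /AX.
    by have := Xn w; lia.
  transitivity (1 - P (A n))%E; first exact: probability_setC.
  by rewrite PAn sube0.
have kE : k = n + 1.
  apply: int_minE => [|i /= Pi]; first by rewrite /= PAn1 lte01.
  have := lbn _ Pi; have [ni|] := eqVneq i n; last lia.
  by move: Pi; rewrite ni PAn ltxx.
by rewrite EX kE PAn PAn1 intrD /=; lra.
Qed.

End ErgodicTheorem.

(** * Rotation numbers *)

Section RotationNumber.
Context {R : realType} d (Omega : measurableType d) (P : probability Omega R).
Variables (theta : Omega -> Omega) (f : Omega -> circle R -> circle R).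
Hypotheses (mp : measure_preserving P theta) (erg : ergodic P theta).
Hypothesis fH : random_circle_homeo f.
Implicit Types a b : R.

Local Notation disp a b n := (fun w => cocycle theta (lift_ab f a b) n w 0).

Lemma displacement_almost_additive a b :
  almost_additive_rv theta (fun n => disp a b n) (`|a| + `|b| + 2).
Proof.
have oH := fH.1; split => //.
- move=> n; apply: measurable_cocycle; first exact: mp.1.
  + by move=> w; have [] := lift_ab_degree_one oH a b w.
  + by move=> w; exact: lift_ab_continuous.
  + by move=> x; exact: measurable_lift_ab.
- by move=> w; exact: lift_ab_bounded.
- move=> m n w; apply: cocycle0_almost_additive => {}w.
  exact: lift_ab_degree_one.
Qed.

(** The limit of the means satisfies the predicate defining the rotation number: convergence from 0
    passes to every starting point, as displacements differ by at most 1. No other real does. *)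
Lemma rotation_number_expectation a b :
  (fun n => \int[P]_w disp a b n w / n%:R) @ \oo --> rotation_number P theta f a b.
Proof.
have [r [er aer]] := almost_additive_ergodic mp erg (displacement_almost_additive a b).
suff -> : rotation_number P theta f a b = r by [].
(* Two almost sure events share a point, at which the uniqueness of limits applies. *)
have aeF : ProperFilter (almost_everywhere P).
  apply: ae_properfilter_algebraOfSetsType.
  by apply: (lt_le_trans lte01); rewrite -(probability_setT P).
apply: xget_subset1.
  move: aer; apply: filterS => w wr x.
  have oH := fH.1; have dF w' := lift_ab_degree_one oH a b w'.
  apply/cvgrPdist_lt => e e0.
  have e2 : 0 < e / 2 by lra.
  move/cvgrPdist_lt : wr => /(_ _ e2)[N _ Nr].
  exists (maxn N (Num.truncn (e / 2)^-1)).+1 => // -[//|n] /= nN.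
  have Nn : (N <= n.+1)%N by lia.
  have := Nr n.+1 Nn; have := cocycle_dist theta dF n.+1 w 0 x.
  have n0 : 0 < n.+1%:R :> R by [].
  have ne : n.+1%:R^-1 < e / 2.
    rewrite invf_plt ?posrE//; apply: (lt_le_trans (truncnS_gt _)).
    by rewrite ler_nat; exact: leq_ltn_trans (leq_maxr _ _) nN.
  rewrite subr0; set y := cocycle _ _ _ _ x - x; set y0 := cocycle _ _ _ _ 0 => yy0.
  have : `|y / n.+1%:R - y0 / n.+1%:R| <= n.+1%:R^-1.
    by rewrite -mulrBl normrM [X in _ * X]gtr0_norm ?invr_gt0// ler_piMl// invr_ge0 ltW.
  move: (n.+1%:R^-1) ne (y0 / _) (y / _) => m me z0 z.
  rewrite !ler_norml !ltr_norml => /andP[? ?] /andP[? ?]; apply/andP; split; lra.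
move=> r1 r2 /= ae1 ae2.
have [w [/(_ 0) w1 /(_ 0) w2]] := @filter_ex _ _ aeF _ (@filterI _ _ _ _ _ ae1 ae2).
exact: (cvg_unique _ w1 w2).
Qed.

Lemma lift_abB_bounded_rv a b a' b' :
  bounded_rv (fun w => lift_ab f a' b' w 0 - lift_ab f a b w 0).
Proof.
split; first by apply: measurable_funB; exact: measurable_lift_ab.
exists (`|a'| + `|b'| + 2 + (`|a| + `|b| + 2)) => w.
by rewrite (le_trans (ler_normB _ _))// lerD// lift_ab_bounded//; exact: fH.1.
Qed.

Lemma lift_ab_int_bounded_rv a b a' b' (X : Omega -> int) :
  (forall w x, lift_ab f a' b' w x = lift_ab f a b w x + (X w)%:~R) ->
  bounded_rv (fun w => (X w)%:~R : R).
Proof.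
move=> XE; have := lift_abB_bounded_rv a b a' b'; congr bounded_rv.
by apply/funext => w; rewrite XE addrC addKr.
Qed.

(** Integer shifts commute with maps of degree one, so they accumulate along the orbit into an
    ergodic sum of [J], whose mean after [n] steps is exactly [n] times that of [J]. *)
Lemma rotation_numberB a b a' b' :
  rotation_number P theta f a' b' - rotation_number P theta f a b =
  \int[P]_w (lift_ab f a' b' w 0 - lift_ab f a b w 0).
Proof.
have oH := fH.1.
have [j jE] := choice (fun w => lift_ab_unique oH a b a' b' w).
set J := fun w => _ - _.
have JE w : J w = (j w)%:~R by rewrite /J jE addrC addKr.
have dispE n w : disp a' b' n w = disp a b n w + \sum_(i < n) J (iter i theta w).
  elim: n => [|n IH]; first by rewrite big_ord0 addr0.
  rewrite /= IH jE big_ord_recr/= JE addrA; congr (_ + _).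
  under eq_bigr do rewrite JE.
  by rewrite -raddf_sum/= degree_one_Dint//; exact: lift_ab_degree_one.
have bJ : bounded_rv J by exact: lift_abB_bounded_rv.
have bd a0 b0 n := almost_additive_bounded_rv (displacement_almost_additive a0 b0) n.
apply: (cvg_unique _ (cvgB (@rotation_number_expectation a' b')
  (@rotation_number_expectation a b))); first exact: norm_hausdorff.
(* The difference of the two ratios is constant once [n] is nonzero. *)
apply: cvg_near_cst; exists 1%N => // -[//|n] _ /=.
have [bS ES] := birkhoff_sum mp n.+1 bJ.
rewrite !fctE.
have -> : \int[P]_w disp a' b' n.+1 w = \int[P]_w disp a b n.+1 w + n.+1%:R * \int[P]_w J w.
  rewrite -ES -RintegralD//; try exact: bounded_rv_integrable.
  by apply: eq_Rintegral => w _; rewrite dispE.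
by rewrite -mulrBl addrC addKr mulrC mulKf.
Qed.

End RotationNumber.

Theorem proposition2p5 (R : realType) (d : measure_display)
    (Omega : measurableType d) (P : probability Omega R)
    (theta : Omega -> Omega) (f : Omega -> circle R -> circle R)
    (q alpha q' alpha' : R) :
  measure_preserving P theta -> ergodic P theta -> random_circle_homeo f ->
  let A (i : int) : set Omega :=
    [set w | alpha' + i%:~R <= lift_ab f q alpha' w q' < alpha' + i%:~R + 1] in
  let B (j : int) : set Omega :=
    [set w | alpha' - j%:~R <= lift_ab f q alpha w q < alpha' - j%:~R + 1] in
  let k : int := int_min [set i : int | (0 < P (A i))%E] in
  let l : int := int_min [set j : int | (0 < P (B j))%E] in
  rotation_number P theta f q' alpha' =
    rotation_number P theta f q alpha
      + fine (P (A k)) - fine (P (B l)) - k%:~R + l%:~R.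
Proof.
move=> mp erg fH A B k l; have oH := fH.1.
(* Both lifts are compared with the intermediate one, of parameters [q] and [alpha']: [X] is the
   index [i] of [A] and [Y] the index [j] of [B]. *)
have [X XE] := choice (fun w => lift_ab_unique oH q' alpha' q alpha' w).
have [Y YE] := choice (fun w => lift_ab_unique oH q alpha q alpha' w).
have [n [z [q'z zq]]] := floor_decomp q q'.
have bX : bounded_rv (fun w => (X w)%:~R : R).
  exact: lift_ab_int_bounded_rv XE.
have bY : bounded_rv (fun w => (Y w)%:~R : R).
  exact: lift_ab_int_bounded_rv YE.
have AX i w : A i w <-> X w = i.
  rewrite /A /= XE; have [_] := lift_abP oH q' alpha' w.
  move: (lift_ab _ _ _ _ _) => y y01; split => [Hy|->]; last lra.
  have : X w - i = 0 by apply: (@int_small_eq0 R); rewrite intrD intrN; lra.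
  lia.
(* With [q' = z + n], the intermediate lift takes at [z] a value in [alpha', alpha' + 2), and
   removing a value in [alpha', alpha' + 1) leaves only two integers. *)
have Xn w : n <= X w <= n + 1.
  have [_ Fq] := lift_abP oH q alpha' w; have [_ Fq'] := lift_abP oH q' alpha' w.
  have [Ginc G1] := lift_ab_degree_one oH q alpha' w.
  have Fz : lift_ab f q alpha' w q <= lift_ab f q alpha' w z < lift_ab f q alpha' w q + 1.
    rewrite -G1; move: zq => /andP[qz zq1]; rewrite Ginc// andbT.
    by move: qz; rewrite le_eqVlt => /predU1P[->//|/Ginc/ltW].
  have := XE w q'; rewrite {1}q'z degree_one_Dint//.
  move: (lift_ab _ _ _ _ q') Fq' => y' Fq' Fz'.
  have : (n - 1 < X w)%R by rewrite -(ltr_int R) intrD intrN; lra.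
  have : (X w < n + 2)%R by rewrite -(ltr_int R) intrD; lra.
  lia.
have BY j w : B j w <-> Y w = j.
  have [_] := lift_abP oH q alpha' w.
  rewrite /B /= YE; move: (lift_ab _ _ _ _ _) => y y01; split => [Hy|<-]; last lra.
  have : Y w - j = 0 by apply: (@int_small_eq0 R); rewrite intrD intrN; lra.
  lia.
(* [Y] is the difference of a point of [alpha', alpha' + 1) and one of [alpha, alpha + 1), so it is
   the floor of [alpha' - alpha] or the next integer. *)
have [m /andP[am ma]] : exists m : int, alpha' - alpha - 1 < m%:~R <= alpha' - alpha.
  exists (Num.floor (alpha' - alpha)).
  by have := floor_itv (alpha' - alpha); rewrite intrD; lra.
have Yn w : m <= Y w <= m + 1.
  have [_] := lift_abP oH q alpha' w; have [_] := lift_abP oH q alpha w.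
  rewrite YE; move: (lift_ab _ _ _ _ _) => y *.
  have : (m - 1 < Y w)%R by rewrite -(ltr_int R) intrD intrN; lra.
  have : (Y w < m + 2)%R by rewrite -(ltr_int R) intrD; lra.
  lia.
have EX : \int[P]_w (X w)%:~R = k%:~R + 1 - fine (P (A k)).
  exact: (Rintegral_two_valued P bX.1 AX Xn).
have EY : \int[P]_w (Y w)%:~R = l%:~R + 1 - fine (P (B l)).
  exact: (Rintegral_two_valued P bY.1 BY Yn).
have := rotation_numberB mp erg fH q alpha q' alpha'.
have -> : \int[P]_w (lift_ab f q' alpha' w 0 - lift_ab f q alpha w 0) =
    \int[P]_w ((Y w)%:~R - (X w)%:~R).
  by apply: eq_Rintegral => w _; have := XE w 0; rewrite YE; lra.
rewrite RintegralB//; try exact: bounded_rv_integrable.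
(* The two summands 1 in the means of [X] and [Y] cancel. *)
by rewrite EX EY; lra.
Qed.
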